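(* Let $k, m$ be positive integers. Every finite simple $k$-connected bipartite graph $G$ with minimum degree $\delta(G)\ge k+m$ contains a path $P$ of order $m$ such that $G-V(P)$ is $k$-connected.
   Context: All graphs are finite and simple. The order of a graph is its number of vertices; a path of order $m$ is a path with exactly $m$ vertices (a path of order $1$ is a single vertex). Paths are subgraphs, not necessarily induced. The connectivity $\kappa(G)$ is the minimum size of a vertex set $S$ such that $G-S$ is disconnected or has only one vertex; $G$ is $k$-connected if $\kappa(G)\ge k$. For $U\subseteq V(G)$, $G-U$ is the induced subgraph on $V(G)\setminus U$. *)

(* Defs.v *)
From mathcomp Require Import all_boot.

Set Implicit Arguments.
Unset Strict Implicit.
Unset Printing Implicit Defensive.

(* A finite simple graph is a finType T of vertices together with an adjacency
   relation e : rel T that is symmetric and irreflexive.  Symmetry and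
   irreflexivity are hypotheses of the theorem, not of these definitions. *)

Definition is_simple_graph (T : finType) (e : rel T) : Prop :=
  symmetric e /\ irreflexive e.

Definition bipartite (T : finType) (e : rel T) : Prop :=
  exists A : {set T}, forall x y, e x y -> (x \in A) != (y \in A).

Definition degree (T : finType) (e : rel T) (x : T) : nat :=
  #|[set y | e x y]|.

(* In an irreflexive graph every degree is < #|T|, so the neutral value #|T|
   only matters for the graph without vertices, whose minimum degree is 0. *)
Definition min_degree (T : finType) (e : rel T) : nat :=
  \big[minn/#|T|]_(x : T) degree e x.

Definition graph_connected (T : finType) (e : rel T) : bool :=
  [forall x, forall y, connect e x y].

(* G - U, the induced subgraph on the complement of U. *)
Definition delete (T : finType) (e : rel T) (U : {set T}) :
    rel {x : T | x \notin U} :=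
  fun x y => e (val x) (val y).
Arguments delete : clear implicits.
Arguments delete {T} e U.

(* "At most one vertex" rather than "exactly one" makes the whole vertex set
   a candidate, so that the minimum below always exists; this does not change
   the minimum of a graph with a vertex, and gives connectivity 0 to the graph
   without vertices. *)
Definition disconnecting (T : finType) (e : rel T) (S : {set T}) : bool :=
  ~~ graph_connected (delete e S) || (#|{: {x : T | x \notin S}}| <= 1).

Definition connectivity (T : finType) (e : rel T) : nat :=
  #|[arg min_(S < [set: T] | disconnecting e S) #|S|]|.

Definition k_connected (k : nat) (T : finType) (e : rel T) : Prop :=
  k <= connectivity e.

(* A path is given by its sequence of vertices; its order is the size of p. *)
Definition is_path (T : finType) (e : rel T) (p : seq T) : bool :=
  [&& p != [::], uniq p & sorted e p].

(* Main.v *)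
(** The path is grown inside a fragment [F], a set whose boundary [N F] has
    exactly [k] vertices.  When [F] is inclusion-minimal, every proper nonempty
    subset of [F] has more than [k] neighbours, so deleting any [y] in [F] leaves
    at least [k] neighbours to each subset of [F], and a subset left with exactly
    [k] contains a neighbour of [y].  Hence the next vertex can be chosen in a
    minimal fragment of what remains, and the path never gets stuck.
    That connectivity inside [F] gives connectivity of the whole graph follows
    from the sub- and posimodularity of [A |-> |N A|].  The one case these leave
    open is a set [A] contained in the boundary of [F]; there the minimum degree
    suffices, because adjacent vertices have disjoint neighbourhoods. *)
Require Import Defs.
From mathcomp Require Import all_boot.
From mathcomp Require Import zify.

Set Implicit Arguments.
Unset Strict Implicit.
Unset Printing Implicit Defensive.

(** * Neighbourhoods of vertex sets: submodularity, posimodularity, triangle-free counting *)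

Section Neighbourhoods.
Variables (T : finType) (e : rel T).

Definition nbhd (A : {set T}) : {set T} :=
  [set y | (y \notin A) && [exists x in A, e x y]].

Lemma nbhdP (A : {set T}) y :
  reflect (y \notin A /\ exists2 x, x \in A & e x y) (y \in nbhd A).
Proof.
rewrite inE; apply: (iffP andP) => -[yA exy]; split=> //.
  by case/exists_inP: exy => x; exists x.
by apply/exists_inP.
Qed.

Lemma nbhd_notin A y : y \in nbhd A -> y \notin A.
Proof. by case/nbhdP. Qed.

Lemma mem_nbhd (A : {set T}) x y :
  x \in A -> e x y -> y \notin A -> y \in nbhd A.
Proof. by move=> xA exy yA; apply/nbhdP; split=> //; exists x. Qed.

Lemma nbhd_sub_closed (A B : {set T}) y :
  A \subset B -> y \in nbhd A -> (y \in B) || (y \in nbhd B).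
Proof.
move=> sAB /nbhdP[yA [x xA exy]]; case: (boolP (y \in B)) => //= yB.
exact: mem_nbhd (subsetP sAB x xA) exy yB.
Qed.

Lemma cardsU_le (A B C : {set T}) : A \subset B :|: C -> #|A| <= #|B| + #|C|.
Proof.
by move=> sABC; apply: leq_trans (subset_leq_card sABC) _; rewrite cardsU leq_subr.
Qed.

Lemma nbhd_submod (W A B : {set T}) :
  #|nbhd (A :&: B) :&: W| + #|nbhd (A :|: B) :&: W|
    <= #|nbhd A :&: W| + #|nbhd B :&: W|.
Proof.
set X := nbhd A :&: W; set Y := nbhd B :&: W.
(* [X] is cut along [B] and [Y] along [A :|: X]. One piece of each covers the neighbours of
   [A :&: B], the other two those of [A :|: B]; a vertex in both [X] and [Y] serves once for
   each. *)
have subI : nbhd (A :&: B) :&: W \subset (X :&: B) :|: (Y :&: (A :|: X)).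
  apply/subsetP => y /setIP[/nbhdP[yAB [x /setIP[xA xB] exy]] yW].
  have nA := mem_nbhd xA exy; have nB := mem_nbhd xB exy.
  rewrite !(in_setU, in_setI) yW !andbT; move: yAB; rewrite in_setI.
  case: (boolP (y \in A)) nA => [yA _|yA -> //] /= yB; first by rewrite nB ?orbT.
  by case: (boolP (y \in B)) nB => //= ? ->; rewrite ?orbT.
have subU : nbhd (A :|: B) :&: W \subset (X :\: B) :|: (Y :\: (A :|: X)).
  apply/subsetP => y /setIP[/nbhdP[yAB [x xAB exy]] yW].
  rewrite !(in_setU, in_setD, in_setI) yW !andbT.
  move: yAB; rewrite in_setU negb_or => /andP[yA yB].
  rewrite yB (negbTE yA) /=; case: (boolP (y \in nbhd A)) => //= yNA.
  case/setUP: xAB => xAB; last exact: mem_nbhd xAB exy yB.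
  by rewrite (mem_nbhd xAB exy yA) in yNA.
have := cardsU_le subI; have := cardsU_le subU.
have := cardsID B X; have := cardsID (A :|: X) Y.
lia.
Qed.

Lemma nbhd_posimod (W A B : {set T}) :
    symmetric e ->
  #|nbhd (A :\: (B :|: nbhd B)) :&: W| + #|nbhd (B :\: (A :|: nbhd A)) :&: W|
    <= #|nbhd A :&: W| + #|nbhd B :&: W|.
Proof.
move=> sym.
(* By symmetry a vertex outside [D :|: nbhd D] has no neighbour in [D]. So a neighbour of what is
   left of [C] avoids [D]; it is a neighbour of [C], or was removed from [C] for lying in
   [nbhd D]. *)
have sub C D : nbhd (C :\: (D :|: nbhd D)) :&: W \subset
    ((nbhd C :&: W) :\: D) :|: ((nbhd D :&: W) :&: C).
  apply/subsetP => y /setIP[/nbhdP[yCD [x /setDP[xC xD] exy]] yW].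
  have nC := mem_nbhd xC exy.
  move: xD; rewrite in_setU negb_or => /andP[xD xND].
  have yD : y \notin D.
    by apply: contra xND => yD; apply: mem_nbhd yD _ xD; rewrite sym.
  rewrite !in_setU !in_setD !in_setI !yW !andbT yD /=.
  case: (boolP (y \in C)) => yC; last by rewrite nC.
  by move: yCD; rewrite in_setD in_setU yC (negbTE yD) andbT negbK /= => ->; rewrite orbT.
have := cardsU_le (sub A B); have := cardsU_le (sub B A).
have := cardsID B (nbhd A :&: W); have := cardsID A (nbhd B :&: W).
lia.
Qed.

Definition nbr (x : T) : {set T} := [set y | e x y].

(** The form in which bipartiteness enters: the ends of an edge have disjoint neighbourhoods. *)
Definition triangle_free := forall x y z, e x y -> e x z -> ~~ e y z.

(* An edge [a b] inside [A] gives two disjoint neighbourhoods in [A :|: nbhd A]. *)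
Lemma triangle_free_card (W A : {set T}) d :
    triangle_free -> A != set0 -> (forall a, a \in A -> d <= #|nbr a :&: W|) ->
  d <= #|nbhd A :&: W| \/ d + d <= #|A| + #|nbhd A :&: W|.
Proof.
move=> tf /set0Pn[a aA] deg.
have sub b : b \in A -> nbr b :&: W \subset A :|: (nbhd A :&: W).
  move=> bA; apply/subsetP => y /setIP[]; rewrite inE => eby yW.
  rewrite in_setU in_setI yW andbT; case: (boolP (y \in A)) => //= yA.
  exact: mem_nbhd bA eby yA.
case: (boolP [exists b in A, e a b]) => [/exists_inP[b bA eab]|noedge].
  right; apply: leq_trans (leq_add (deg a aA) (deg b bA)) _.
  have dis : [disjoint nbr a :&: W & nbr b :&: W].
    apply/pred0P => y /=; rewrite !inE; apply/negP.
    by case/andP=> /andP[eay _] /andP[eby _]; move: (tf _ _ _ eab eay); rewrite eby.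
  rewrite -cardsUI (disjoint_setI0 dis) cards0 addn0.
  by apply: cardsU_le; rewrite subUset !sub.
left; apply: leq_trans (deg a aA) (subset_leq_card _).
apply/subsetP => y /setIP[]; rewrite inE => eay yW; rewrite in_setI yW andbT.
apply: (mem_nbhd aA eay); apply: contra noedge => yA.
by apply/exists_inP; exists y.
Qed.

Hypothesis sym : symmetric e.
Hypothesis tf : triangle_free.
Variable k : nat.
Hypothesis k_gt0 : 0 < k.

(* For [#|S| = k], [rooted W S] says that adding all edges inside [S] makes the
   graph induced on [W] [k]-connected. *)
Definition rooted (W S : {set T}) := forall A : {set T},
  A != set0 -> A \subset W :\: S -> k <= #|nbhd A :&: W|.

(** This is [k]-connectivity of the graph induced on [W], up to the condition of having more than
    [k] vertices. Working with subsets of a fixed [T] avoids a new vertex type after each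
    deletion. *)
Definition separation_bound (W : {set T}) := forall A : {set T},
  A != set0 -> A \subset W -> ~~ (W \subset A :|: nbhd A) ->
  k <= #|nbhd A :&: W|.

(** * Gluing: from bounds inside a fragment to bounds on the whole set *)

Section Gluing.
Variables V F P : {set T}.
Hypotheses (sFV : F \subset V) (sPF : P \subset F).
Hypothesis boundary : #|nbhd F :&: V| = k.
Hypothesis rootedF :
  rooted ((F :|: nbhd F :&: V) :\: P) (nbhd F :&: V).
Hypothesis F_large : k <= #|F :\: P|.

Lemma fragment_inner (B : {set T}) :
  B != set0 -> B \subset F :\: P -> k <= #|nbhd B :&: (V :\: P)|.
Proof.
move=> B0 sBF; apply: (leq_trans (rootedF B0 _)).
  apply/subsetP => x /(subsetP sBF); rewrite !in_setD !in_setU in_setI.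
  case/andP=> -> xF; rewrite xF andbT.
  by rewrite negb_and (contraTN (@nbhd_notin F x)) ?xF.
apply/subset_leq_card/subsetP => x; rewrite !in_setI !in_setD in_setU in_setI.
case/and3P=> -> -> /orP[/(subsetP sFV) -> //|/andP[_ ->] //].
Qed.

(** Outside [P], a neighbour of [F :\: P] is a neighbour of [F], which gives one inclusion.
    Rootedness supplies at least [k] such vertices, so no boundary vertex is lost. *)
Lemma boundary_remains : nbhd (F :\: P) :&: (V :\: P) = nbhd F :&: V.
Proof.
apply/eqP; rewrite eqEcard boundary fragment_inner //; last first.
  by rewrite -card_gt0; apply: leq_trans F_large.
rewrite andbT; apply/subsetP => x /setIP[/nbhdP[xFP [y /setDP[yF _] eyx]]].
case/setDP=> xV xP; rewrite in_setI xV andbT (mem_nbhd yF eyx) //.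
by apply: contra xFP => xF; rewrite in_setD xP.
Qed.

(* Posimodularity applied to [A] and [F :\: P]. *)
Lemma fragment_covered (A : {set T}) :
    A \subset V :\: P -> #|nbhd A :&: (V :\: P)| < k ->
    k <= #|nbhd (A :\: (F :|: nbhd F)) :&: V| ->
  F :\: P \subset A :|: nbhd A.
Proof.
move=> sAW small outer_large.
apply: contraLR small; rewrite -leqNgt -setD_eq0 => inner.
have := nbhd_posimod (V :\: P) A (F :\: P) sym.
rewrite boundary_remains boundary.
have := fragment_inner inner (subsetDl _ _).
(* No vertex outside [F :|: nbhd F] has a neighbour in [F], hence none in [P]; the outer part of [A]
   keeps its whole neighbourhood. *)
suff -> : nbhd (A :\: (F :\: P :|: nbhd (F :\: P))) :&: (V :\: P) =
          nbhd (A :\: (F :|: nbhd F)) :&: V by lia.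
have -> : A :\: (F :\: P :|: nbhd (F :\: P)) = A :\: (F :|: nbhd F).
  apply/setP => x; rewrite ![in LHS]in_setD ![in RHS]in_setD !in_setU.
  case: (boolP (x \in A)) => [/(subsetP sAW) xW|]; last by rewrite !andbF.
  rewrite !andbT in_setD; have := xW; rewrite in_setD => /andP[-> xV] /=.
  congr (~~ (_ || _)); have /setP/(_ x) := boundary_remains.
  by rewrite !in_setI xW xV !andbT.
apply/setP => x; rewrite !in_setI in_setD.
case: (boolP (x \in nbhd _)) => //= /nbhdP[_ [y /setDP[yA yFN] eyx]].
case: (boolP (x \in P)) => //= /(subsetP sPF) xF.
case/negP: yFN; rewrite in_setU -implyNb; apply/implyP.
by apply: mem_nbhd xF _; rewrite sym.
Qed.

(** Either [triangle_free_card] gives the bound at once, or it gives [k + k] as a lower bound for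
    [#|A|] plus the neighbours, where [#|A| <= k]. *)
Lemma boundary_large (A : {set T}) :
    (forall a, a \in A -> k <= #|nbr a :&: (V :\: P)|) ->
  A != set0 -> A \subset nbhd F :&: V -> k <= #|nbhd A :&: (V :\: P)|.
Proof.
move=> deg A0 sA; have := subset_leq_card sA; rewrite boundary.
by have [] := triangle_free_card tf A0 deg; lia.
Qed.

Lemma glue_rooted (S : {set T}) :
    F \subset V :\: S -> rooted V S ->
    (forall a, a \in V :\: P -> a \notin S -> k <= #|nbr a :&: (V :\: P)|) ->
  rooted (V :\: P) S.
Proof.
move=> sFVS rV deg A A0 sA; rewrite leqNgt; apply/negP => small.
have sAW : A \subset V :\: P by apply: subset_trans sA (subsetDl _ _).
have sAVS : A \subset V :\: S.
  by apply: subset_trans sA _; rewrite setDDl setUC -setDDl subsetDl.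
have [AF0|AF] := eqVneq (A :&: F) set0; last first.
  have := nbhd_submod (V :\: P) A (F :\: P).
  have AFP : A :&: (F :\: P) = A :&: F.
    apply/setP => x; rewrite !in_setI in_setD.
    by case: (boolP (x \in A)) => //= /(subsetP sAW); rewrite in_setD => /andP[->].
  rewrite boundary_remains boundary AFP.
  have : k <= #|nbhd (A :&: F) :&: (V :\: P)|.
    by apply: fragment_inner; rewrite // -AFP subsetIr.
  (* Submodularity reduces the claim to this union. The boundary of [F] survives, so every neighbour
     of [A :|: F] in [V] is still one of [A :|: (F :\: P)], and [rV] applies. *)
  suff : k <= #|nbhd (A :|: (F :\: P)) :&: (V :\: P)| by lia.
  have AFVS : A :|: F \subset V :\: S by rewrite subUset sAVS.
  have AF0 : A :|: F != set0.
    by apply: contraNneq A0 => AF0; rewrite -subset0 -AF0 subsetUl.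
  apply: leq_trans (rV _ AF0 AFVS) (subset_leq_card _).
  apply/subsetP => x /setIP[/nbhdP[]]; rewrite in_setU negb_or => /andP[xA xF].
  move=> [y yAF eyx] xV; rewrite in_setI in_setD xV andbT.
  rewrite (contra (subsetP sPF x)) // andbT.
  have xAFP : x \notin A :|: (F :\: P).
    by rewrite in_setU in_setD (negbTE xA) (negbTE xF) andbF.
  case/setUP: yAF => [yA|yF].
    by apply: mem_nbhd _ eyx xAFP; rewrite in_setU yA.
  have : x \in nbhd F :&: V by rewrite in_setI xV (mem_nbhd yF).
  rewrite -boundary_remains => /setIP[/nbhdP[_ [z zF ezx]] _].
  by apply: mem_nbhd _ ezx xAFP; rewrite in_setU zF orbT.
have AnF x : x \in A -> x \notin F.
  by move=> xA; apply/negP => xF; have := in_set0 x; rewrite -AF0 in_setI xA xF.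
have [outer0|outer] := eqVneq (A :\: (F :|: nbhd F)) set0.
  have : k <= #|nbhd A :&: (V :\: P)|; last by rewrite leqNgt small.
  apply: boundary_large => //.
    by move=> a aA; apply: deg; [exact: (subsetP sAW) | have /setDP[] := subsetP sA a aA].
  apply/subsetP => x xA; rewrite in_setI.
  have /setDP[-> _] := subsetP sAW x xA; rewrite andbT.
  move/eqP: outer0; rewrite setD_eq0 => /subsetP/(_ x xA).
  by rewrite in_setU (negbTE (AnF x xA)).
(* As [A] misses [F], this cover puts all of [F :\: P], at least [k] vertices, into the
   neighbourhood of [A]. *)
have cover : F :\: P \subset A :|: nbhd A.
  apply: fragment_covered => //; apply: rV => //.
  exact: subset_trans (subsetDl _ _) sAVS.
have : F :\: P \subset nbhd A :&: (V :\: P).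
  apply/subsetP => x xFP; have := subsetP cover x xFP.
  have /setDP[xF xP] := xFP.
  rewrite in_setU in_setI in_setD xP (subsetP sFV) // andbT.
  by have /negbTE -> := contraTN (AnF x) xF; rewrite andbT.
by move=> sFN; have := leq_trans F_large (subset_leq_card sFN); rewrite leqNgt small.
Qed.

(** Let [A] and [B] be the two sides of a separation by fewer than [k] vertices [X]. If one side
    reaches beyond [F :|: nbhd F], it and [X] cover [F :\: P]; the other side then misses [F], does
    not fit in the boundary, and so covers as well, forcing [F :\: P] into [X]. If neither does, [X]
    contains everything beyond [F :|: nbhd F]. Both sets are too large for [X]. *)
Lemma glue_separation :
    separation_bound V -> k <= #|V :\: (F :|: nbhd F)| ->
    (forall a, a \in V :\: P -> k <= #|nbr a :&: (V :\: P)|) ->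
  separation_bound (V :\: P).
Proof.
move=> sepV R_large deg A A0 sA nocover; rewrite leqNgt; apply/negP => small.
set X := nbhd A :&: (V :\: P) in small.
have covered (C : {set T}) : C \subset V :\: P -> nbhd C :&: (V :\: P) \subset X ->
    C :\: (F :|: nbhd F) != set0 -> F :\: P \subset C :|: nbhd C.
  move=> sC sNC CR0.
  apply: (fragment_covered sC (leq_ltn_trans (subset_leq_card sNC) small)).
  have /set0Pn[f /setDP[fF _]] : F :\: P != set0.
    by rewrite -card_gt0; apply: leq_trans F_large.
  apply: sepV => //.
    apply: subset_trans (subsetDl _ _) (subset_trans sC (subsetDl _ _)).
  apply: contraL fF => /subsetP coverV; apply/negP => fF.
  move: (coverV f (subsetP sFV f fF)); rewrite in_setU in_setD in_setU fF /=.
  case/nbhdP=> _ [y /setDP[yC]]; rewrite in_setU negb_or => /andP[yF].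
  move=> yNF eyf; case/negP: yNF; apply: mem_nbhd fF _ yF; by rewrite sym.
have not_in_boundary (C : {set T}) : C \subset V :\: P ->
    nbhd C :&: (V :\: P) \subset X -> C != set0 -> ~~ (C \subset nbhd F).
  move=> sC sNC C0; apply/negP => sCF.
  have := subset_leq_card sNC; apply/negP; rewrite -ltnNge.
  apply: leq_trans small _; apply: boundary_large => //.
    by move=> a /(subsetP sC)/deg.
  by rewrite subsetI sCF; apply: subset_trans sC (subsetDl _ _).
have absurd (C D : {set T}) : C \subset V :\: P -> D \subset V :\: P ->
    nbhd C :&: (V :\: P) \subset X -> nbhd D :&: (V :\: P) \subset X ->
    [disjoint C & D] -> [disjoint D & X] -> D != set0 ->
    C :\: (F :|: nbhd F) != set0 -> False.
  move=> sC sD sNC sND disCD disDX D0 CR0.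
  have in_CX x : x \in V :\: P -> x \in F -> x \in C :|: X.
    move=> xW xF; have xFP : x \in F :\: P.
      by have /setDP[_ xP] := xW; rewrite in_setD xP.
    have /setUP[xC|xNC] := subsetP (covered C sC sNC CR0) x xFP.
      by rewrite in_setU xC.
    by rewrite in_setU (subsetP sNC) ?orbT // in_setI xNC.
  have DF x : x \in D -> x \notin F.
    move=> xD; apply/negP => xF; have xW := subsetP sD x xD.
    have /setUP[xC|xX] := in_CX x xW xF.
      by rewrite (disjointFr disCD xC) in xD.
    by rewrite (disjointFr disDX xD) in xX.
  have [DR0|DR0] := eqVneq (D :\: (F :|: nbhd F)) set0.
    case/negP: (not_in_boundary D sD sND D0); apply/subsetP => x xD.
    move/eqP: DR0; rewrite setD_eq0 => /subsetP/(_ x xD); case/setUP=> // xF.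
    by have := DF x xD; rewrite xF.
  have : F :\: P \subset X.
    apply/subsetP => x xFP; have /setDP[xF xP] := xFP.
    have /setUP[xD|xND] := subsetP (covered D sD sND DR0) x xFP.
      by have := DF x xD; rewrite xF.
    by apply: (subsetP sND); rewrite in_setI xND in_setD xP (subsetP sFV).
  by move=> sFX; have := leq_trans F_large (subset_leq_card sFX); rewrite leqNgt small.
pose B := (V :\: P) :\: (A :|: nbhd A).
have sB : B \subset V :\: P by apply: subsetDl.
have sNB : nbhd B :&: (V :\: P) \subset X.
  apply/subsetP => x /setIP[/nbhdP[xB [y /setDP[yW]]]].
  rewrite in_setU negb_or => /andP[yA yNA] eyx xW; rewrite in_setI xW andbT.
  move: xB; rewrite in_setD xW andbT negbK in_setU => /orP[xA|//].
  by case/negP: yNA; apply: mem_nbhd xA _ yA; rewrite sym.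
have disAX : [disjoint A & X].
  apply/pred0P => x /=; rewrite in_setI.
  by case: (boolP (x \in nbhd A)) => [/nbhd_notin/negbTE->|]; rewrite ?andbF.
have disAB : [disjoint A & B].
  by apply/pred0P => x /=; rewrite in_setD in_setU; case: (x \in A).
have disBX : [disjoint B & X].
  apply/pred0P => x /=; rewrite in_setD in_setU in_setI.
  by case: (x \in nbhd A); rewrite ?orbT ?andbF.
have B0 : B != set0 by rewrite setD_eq0.
have [AR0|/(absurd A B)] := eqVneq (A :\: (F :|: nbhd F)) set0; last exact.
have [BR0|/(absurd B A)] := eqVneq (B :\: (F :|: nbhd F)) set0; last first.
  by apply=> //; rewrite disjoint_sym.
have sRX : V :\: (F :|: nbhd F) \subset X.
  apply/subsetP => x /setDP[xV xFN].
  have xW : x \in V :\: P.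
    rewrite in_setD xV andbT; apply: contra xFN => /(subsetP sPF) xF.
    by rewrite in_setU xF.
  have xA : x \notin A.
    by apply: contra xFN; apply/subsetP; rewrite -setD_eq0 AR0.
  have xB : x \notin B.
    by apply: contra xFN; apply/subsetP; rewrite -setD_eq0 BR0.
  rewrite in_setI xW andbT; move: xB.
  by rewrite in_setD xW andbT negbK in_setU (negbTE xA).
by have := leq_trans R_large (subset_leq_card sRX); rewrite leqNgt small.
Qed.

End Gluing.

(** * Deleting vertices, and growing the path inside a minimal fragment *)

Lemma nbhd_delete (V A : {set T}) y :
  #|nbhd A :&: V| <= #|nbhd A :&: (V :\ y)| + [exists a in A, e y a].
Proof.
have [noedge|noedge] := boolP [exists a in A, e y a].
  rewrite addn1 -add1n -(cards1 y); apply: cardsU_le; apply/subsetP => x.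
  by rewrite !inE; case: (x == y).
rewrite addn0; apply/subset_leq_card/subsetP => x /setIP[xNA xV].
rewrite in_setI xNA in_setD1 xV andbT; apply: contra noedge => /eqP <-.
by case/nbhdP: xNA => _ [a aA eax]; apply/exists_inP; exists a; rewrite // sym.
Qed.

Lemma nbr_delete (V P : {set T}) d n a :
  d + n <= #|nbr a :&: V| -> #|P| <= n -> d <= #|nbr a :&: (V :\: P)|.
Proof.
move=> deg cP; have : nbr a :&: V \subset (nbr a :&: (V :\: P)) :|: P.
  apply/subsetP => x; rewrite in_setU !in_setI in_setD.
  by case: (x \in P); rewrite ?orbT ?orbF.
by move/cardsU_le; lia.
Qed.

Lemma card_set_seq_le (p : seq T) n : size p = n -> #|[set z in p]| <= n.
Proof. by move=> <-; rewrite cardsE card_size. Qed.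

Lemma fragment_card_large (V F P : {set T}) m :
    (forall a, a \in F -> k + m.+1 <= #|nbr a :&: V|) -> F != set0 ->
    #|nbhd F :&: V| <= k -> #|P| <= m.+1 ->
  k <= #|F :\: P|.
Proof.
move=> deg F0 cNF cP; have : #|F| <= #|F :\: P| + #|P|.
  by rewrite -(cardsID P F) addnC leq_add2l subset_leq_card ?subsetIr.
by have := triangle_free_card tf F0 deg; lia.
Qed.

Definition minimal_fragment (V F : {set T}) :=
  forall A : {set T}, A != set0 -> A \proper F -> k < #|nbhd A :&: V|.

Section Delete.
Variables (V F : {set T}) (y : T).
Hypotheses (minF : minimal_fragment V F) (yF : y \in F).
Let S := nbhd F :&: V.
Let V' := (F :|: S) :\ y.

(** The boolean counts as 0 or 1, so the strict inequality says two things: at least [k] neighbours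
    remain, and if exactly [k] remain then [A] contains a neighbour of [y]. *)
Lemma minimal_fragment_delete (A : {set T}) :
    A != set0 -> A \subset F :\ y ->
  k < #|nbhd A :&: V'| + [exists a in A, e y a].
Proof.
rewrite subsetD1 => A0 /andP[sAF yA].
apply: leq_trans (nbhd_delete _ _ _).
apply: leq_trans (_ : #|nbhd A :&: V| <= _).
  by apply: minF => //; rewrite properE sAF; apply: contra yA => /subsetP; apply.
apply/subset_leq_card/subsetP => x /setIP[xNA xV].
by rewrite in_setI xNA in_setU in_setI xV andbT (nbhd_sub_closed sAF xNA).
Qed.

Lemma delete_inside : V' :\: S \subset F :\ y.
Proof.
apply/subsetP => x; rewrite !in_setD in_setU in_set1.
by case/and3P=> /negbTE-> ->; rewrite orbF.
Qed.

Lemma inside_delete : F :\ y \subset V' :\: S.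
Proof.
apply/subsetP => x /setD1P[xy xF]; rewrite in_setD (in_setD1 x) xy in_setU xF andbT.
by rewrite in_setI negb_and (contraTN (@nbhd_notin F x)) ?xF.
Qed.

Lemma rooted_delete : rooted V' S.
Proof.
move=> A A0 /subset_trans/(_ delete_inside)/(minimal_fragment_delete A0).
by case: [exists a in A, e y a]; lia.
Qed.

End Delete.

(** Induction on [m] with [V] and [F] varying: the next step takes place in [V'], the fragment with
    its boundary but without [y]. Each step uses up one unit of the degree bound. *)
Lemma fragment_path m (V F : {set T}) y :
    F \subset V -> #|nbhd F :&: V| = k ->
    (forall a, a \in F -> k + m.+1 <= #|nbr a :&: V|) ->
    minimal_fragment V F -> y \in F ->
  exists p, [/\ path e y p, uniq (y :: p), size p = m,
    [set z in y :: p] \subset F &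
    rooted ((F :|: nbhd F :&: V) :\: [set z in y :: p]) (nbhd F :&: V)].
Proof.
elim: m V F y => [|m IH] V F y sFV boundary deg minF yF;
  have rV' := rooted_delete minF yF;
  have sV'F := delete_inside V F y; have sFV'S := inside_delete V F y;
  set S := nbhd F :&: V in boundary rV' sV'F sFV'S *;
  set V' := (F :|: S) :\ y in rV' sV'F sFV'S.
- exists [::]; have -> : [set z in [:: y]] = [set y].
    by apply/setP => z; rewrite !inE.
  by split=> //; rewrite sub1set.
have sFS : F \subset F :|: S := subsetUl _ _.
have sFyV' : F :\ y \subset V' := setSD _ sFS.
have del (A : {set T}) := @minimal_fragment_delete V F y minF yF A.
(* The degree of [y] exceeds [k], the size of [S], so [y] has a neighbour in [F]. *)
have Fy0 : F :\ y != set0.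
  rewrite -card_gt0; have : nbr y :&: V \subset (F :\ y) :|: S.
    apply/subsetP => x /setIP[]; rewrite inE => eyx xV.
    have xy : x != y.
      by apply: contraTneq eyx => ->; apply/negP => eyy; case/negP: (tf eyy eyy).
    rewrite in_setU in_setD1 in_setI xV xy andbT /=.
    by case: (boolP (x \in F)) => //= xF; apply: mem_nbhd yF eyx xF.
  by move/cardsU_le; have := deg y yF; lia.
pose tight (A : {set T}) := [&& A != set0, A \subset F :\ y & #|nbhd A :&: V'| <= k].
have tightF : tight (F :\ y).
  rewrite /tight Fy0 subxx /= -boundary; apply/subset_leq_card/subsetP => x.
  case/setIP=> /nbhd_notin xFy /setD1P[xy]; rewrite in_setD1 xy /= in xFy.
  by rewrite in_setU (negbTE xFy).
have /ex_minset[F2 /minsetP[/and3P[F20 sF2 cF2] minF2]] : exists A, tight A.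
  by exists (F :\ y).
have boundary2 : #|nbhd F2 :&: V'| = k.
  apply/eqP; rewrite eqn_leq cF2 rV' //; exact: subset_trans sF2 sFV'S.
have degV' a : a \in F -> k + m.+1 <= #|nbr a :&: V'|.
  move=> aF; apply: (@nbr_delete (F :|: S) [set y] _ 1); last by rewrite cards1.
  rewrite addn1 -addnS; apply: leq_trans (deg a aF) (subset_leq_card _).
  apply/subsetP => x /setIP[eax xV]; rewrite in_setI eax in_setU in_setI xV andbT /=.
  case: (boolP (x \in F)) => //= xF; apply: mem_nbhd aF _ xF.
  by rewrite inE in eax.
have F2F a : a \in F2 -> a \in F by move/(subsetP sF2)/setD1P=> [].
(* The boundary of [F2] has exactly [k] vertices, so the strict bound [del] forces its boolean to be
   true. *)
have [z zF2 eyz] : exists2 z, z \in F2 & e y z.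
  apply/exists_inP; have := del F2 F20 sF2; rewrite boundary2.
  by case: [exists _ in _, _] => //; lia.
have [|||p [pz pu ps pF2 rp]] // := IH V' F2 z (subset_trans sF2 sFyV') boundary2.
- by move=> a /F2F; apply: degV'.
- move=> A A0 pAF2; rewrite ltnNge; apply: contraTN pAF2 => cA.
  rewrite properE; apply/negP => /andP[sA]; apply/negP; rewrite negbK.
  rewrite (minF2 A _ sA) // /tight A0 cA andbT; exact: subset_trans sA sF2.
have cP : #|[set t in z :: p]| <= m.+1 by apply: card_set_seq_le; rewrite /= ps.
have setE W : W :\: [set t in [:: y, z & p]] = (W :\ y) :\: [set t in z :: p].
  by rewrite setDDl; congr (_ :\: _); apply/setP => t; rewrite !inE.
exists (z :: p); split.
- by rewrite /= eyz.
- rewrite cons_uniq pu andbT; apply/negP => yp.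
  by have := subsetP pF2 y; rewrite inE => /(_ yp)/(subsetP sF2); rewrite setD11.
- by rewrite /= ps.
- apply/subsetP => t; rewrite !inE => /predU1P[-> //|tp]; apply: F2F.
  by apply: (subsetP pF2); rewrite inE.
(* The induction hypothesis is rooted at the boundary of [F2]; gluing along [F2] inside [V'] moves
   the root back to [S]. *)
rewrite setE; apply: (glue_rooted (F := F2)) => //.
- exact: subset_trans sF2 sFyV'.
- by apply: fragment_card_large cP => [a /F2F||]; [apply: degV'| |].
- exact: subset_trans sF2 sFV'S.
move=> a /setDP[aV' _] aS; apply: nbr_delete cP; apply: degV'.
by have := subsetP sV'F a; rewrite in_setD aS => /(_ aV')/setD1P[].
Qed.

(** * The path in the whole graph, with or without a fragment *)

Definition fragment (V A : {set T}) :=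
  [&& A != set0, A \subset V, ~~ (V \subset A :|: nbhd A) &
      #|nbhd A :&: V| <= k].

(** [Y] holds the permitted first vertices, later the neighbours of the preceding path vertex.
    Meeting every fragment, it meets a minimal one, where the path can start. *)
Lemma fragment_separation_path m (V Y A : {set T}) :
    separation_bound V -> (forall a, a \in V -> k + m.+1 <= #|nbr a :&: V|) ->
    (forall B, fragment V B -> Y :&: B != set0) -> fragment V A ->
  exists y p, [/\ y \in Y, path e y p, uniq (y :: p) & size p = m] /\
    [set z in y :: p] \subset V /\
    separation_bound (V :\: [set z in y :: p]).
Proof.
move=> sepV deg hit fragA.
have /ex_minset[F /minsetP[fragF minF]] : exists B, fragment V B by exists A.
have /set0Pn[y /setIP[yY yF]] := hit F fragF.
have /and4P[F0 sFV ncF cF] := fragF.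
have boundary : #|nbhd F :&: V| = k by apply/eqP; rewrite eqn_leq cF sepV.
have degF a : a \in F -> k + m.+1 <= #|nbr a :&: V|.
  by move/(subsetP sFV); apply: deg.
have [|p [ep up sp pF rp]] := fragment_path sFV boundary degF _ yF.
  move=> B B0 pBF; rewrite ltnNge; apply: contraTN pBF => cB.
  rewrite properE; apply/negP => /andP[sBF]; apply/negP; rewrite negbK.
  rewrite (minF B) // /fragment B0 cB (subset_trans sBF) // andbT /=.
  apply: contra ncF => /subset_trans; apply; apply/subsetP => x.
  rewrite !in_setU => /orP[/(subsetP sBF) -> //|].
  exact: nbhd_sub_closed.
have cP : #|[set t in y :: p]| <= m.+1 by apply: card_set_seq_le; rewrite /= sp.
exists y, p; do 2!split=> //; first exact: subset_trans pF sFV.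
apply: (glue_separation (F := F)) => //.
- exact: fragment_card_large degF F0 cF cP.
(* The far side of [F] has its neighbours in the boundary of [F], so the same degree count, with
   nothing deleted, makes it large. *)
- rewrite -(setD0 (V :\: (F :|: nbhd F))).
  apply: (@fragment_card_large V _ _ m) => [a /setDP[/deg] //|||]; last by rewrite cards0.
    by rewrite setD_eq0.
  rewrite -boundary; apply/subset_leq_card/subsetP => x.
  case/setIP=> /nbhdP[xR [z /setDP[zV]]]; rewrite in_setU negb_or => /andP[zF zNF].
  move=> ezx xV; rewrite in_setI xV andbT; move: xR.
  rewrite in_setD xV andbT negbK => /setUP[xF|//].
  by case/negP: zNF; apply: mem_nbhd xF _ zF; rewrite sym.
by move=> a /setDP[/deg dega _]; apply: nbr_delete cP.
Qed.

Section NoFragment.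
Variables (V : {set T}) (y : T).
Hypothesis nofrag : forall A, ~~ fragment V A.

Lemma no_fragment_delete (A : {set T}) :
    A != set0 -> A \subset V :\ y -> ~~ (V :\ y \subset A :|: nbhd A) ->
  k < #|nbhd A :&: (V :\ y)| + [exists a in A, e y a].
Proof.
rewrite subsetD1 => A0 /andP[sAV _] nc.
apply: leq_trans (nbhd_delete _ _ _); rewrite ltnNge.
apply: contra (nofrag A) => cA; rewrite /fragment A0 sAV cA andbT /=.
by apply: contra nc; apply: subset_trans; apply: subsetDl.
Qed.

Lemma separation_bound_delete1 : separation_bound (V :\ y).
Proof.
move=> A A0 sA nc; have := no_fragment_delete A0 sA nc.
by case: [exists a in A, e y a]; lia.
Qed.

End NoFragment.

(** Without a fragment any vertex of [Y] in [V] may be deleted, and the path continues among its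
    neighbours. As soon as a fragment exists, the rest of the path is found inside a minimal one. *)
Lemma separation_path m (V Y : {set T}) :
    separation_bound V -> (forall a, a \in V -> k + m.+1 <= #|nbr a :&: V|) ->
    (forall B, fragment V B -> Y :&: B != set0) -> Y :&: V != set0 ->
  exists y p, [/\ y \in Y, path e y p, uniq (y :: p) & size p = m] /\
    [set z in y :: p] \subset V /\
    separation_bound (V :\: [set z in y :: p]).
Proof.
elim: m V Y => [|m IH] V Y sepV deg hit /set0Pn[y /setIP[yY yV]];
  have [/existsP[A fragA]|] := boolP [exists A, fragment V A];
  try exact: fragment_separation_path sepV deg hit fragA;
  rewrite negb_exists => /forallP nofrag;
  have sepVy := @separation_bound_delete1 V y nofrag.
  exists y, [::]; have -> : [set z in [:: y]] = [set y].
    by apply/setP => z; rewrite !inE.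
  by do 2!split=> //; rewrite sub1set.
have degVy a : a \in V -> k + m.+1 <= #|nbr a :&: (V :\ y)|.
  move=> aV; apply: (@nbr_delete V [set y] _ 1); last by rewrite cards1.
  by rewrite addn1 -addnS deg.
(* [nbr y] meets every fragment of [V :\ y]: a set reduced to [k] neighbours by deleting [y]
   contains a neighbour of [y]. *)
have [|||z [p [[eyz pz pu ps] [sp sepp]]]] := IH (V :\ y) (nbr y) sepVy.
- by move=> a /setD1P[_]; apply: degVy.
- move=> B /and4P[B0 sB nc cB].
  have : [exists a in B, e y a].
    have := no_fragment_delete nofrag B0 sB nc.
    by case: [exists a in B, e y a] => //; lia.
  by case/exists_inP=> a aB eya; apply/set0Pn; exists a; rewrite in_setI inE eya.
- by rewrite -card_gt0; apply: leq_trans (degVy y yV); rewrite addnS.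
rewrite inE in eyz.
have setE : [set t in [:: y, z & p]] = y |: [set t in z :: p].
  by apply/setP => t; rewrite !inE.
exists y, (z :: p); rewrite setE -setDDl subUset sub1set yV; split.
  split=> //; first by rewrite /= eyz.
    rewrite cons_uniq pu andbT; apply/negP => yp.
    by have := subsetP sp y; rewrite inE => /(_ yp); rewrite setD11.
  by rewrite /= ps.
by split=> //; apply: subset_trans sp (subsetDl _ _).
Qed.

End Neighbourhoods.

(** * Translation to [connectivity] and to induced subgraphs *)

Lemma disconnecting_setT (T : finType) (e : rel T) : disconnecting e [set: T].
Proof.
by apply/orP; right; rewrite card_sub eq_card0 // => x; rewrite !inE.
Qed.

(** If a minimum disconnecting set [S] leaves at most one vertex, [k < #|T|] gives the bound.
    Otherwise a component of the rest has all its neighbours in [S]. *)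
Lemma separation_bound_connected (T : finType) (e : rel T) k :
    k < #|T| -> separation_bound e k setT -> k_connected k e.
Proof.
move=> big sep; rewrite /k_connected /connectivity.
have dT := disconnecting_setT e.
case: arg_minnP => // S dS _.
have cS : #|{: {x : T | x \notin S}}| = #|T| - #|S|.
  by rewrite card_sub -(cardsC S) addKn; apply: eq_card => x; rewrite !inE.
case/orP: dS => [|]; last by rewrite cS; lia.
rewrite negb_forall => /existsP[x]; rewrite negb_forall => /existsP[y nxy].
pose A := [set val z | z in connect (delete e S) x].
have memA z : (val z \in A) = connect (delete e S) x z.
  by rewrite mem_imset //; apply: val_inj.
have sN : nbhd e A \subset S.
  apply/subsetP => z /nbhdP[zA [_ /imsetP[u xu ->] euz]].
  apply: contraR zA => zS; have := memA (Sub z zS); rewrite SubK => ->.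
  by apply: (connect_trans (y := u)) => //; apply: connect1.
have := @sep A; rewrite subsetT setIT => /(_ _ isT) sepA.
apply: leq_trans (sepA _ _) (subset_leq_card sN).
  by apply/set0Pn; exists (val x); rewrite memA connect0.
apply/negP => /subsetP/(_ (val y) (in_setT _)); rewrite in_setU memA (negbTE nxy) /=.
by move/(subsetP sN); rewrite (negbTE (valP y)).
Qed.

(** [nbhd e A] is itself disconnecting: a walk from [A] that avoids it never leaves [A]. *)
Lemma connected_separation_bound (T : finType) (e : rel T) k :
  k_connected k e -> separation_bound e k setT.
Proof.
rewrite /k_connected /connectivity; have dT := disconnecting_setT e.
case: arg_minnP => // S dS minS kS A /set0Pn[a aA] _ /subsetPn[b _].
rewrite in_setU negb_or setIT => /andP[bA bN].
apply: (leq_trans kS); apply: minS; apply/orP; left.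
have aN : a \notin nbhd e A by apply: contraTN aA => /nbhd_notin.
rewrite negb_forall; apply/existsP; exists (Sub a aN).
rewrite negb_forall; apply/existsP; exists (Sub b bN); apply/negP.
case/connectP=> p.
have : val (Sub a aN : {x | x \notin nbhd e A}) \in A by [].
elim: p (Sub a aN : {x | x \notin nbhd e A}) => [|v p IH] u uA /=.
  by move=> _ E; rewrite -E in uA; rewrite uA in bA.
case/andP=> euv; apply: IH; apply: contraNT (valP v) => vA.
exact: mem_nbhd uA euv vA.
Qed.

Lemma nbhd_delete_graph (T : finType) (e : rel T) (U : {set T})
    (A : {set {x : T | x \notin U}}) :
  nbhd e (val @: A) :\: U = val @: nbhd (delete e U) A.
Proof.
apply/setP => x; apply/setDP/imsetP => [[/nbhdP[xA [_ /imsetP[a aA ->] eax]] xU]|].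
  exists (Sub x xU) => //; apply: (mem_nbhd aA eax).
  by apply: contra xA => xA; apply/imsetP; exists (Sub x xU).
case=> u /nbhdP[uA [a aA eau]] ->; split; last exact: (valP u).
apply: (@mem_nbhd _ e _ (val a)); [exact: imset_f | exact: eau |].
by rewrite mem_imset //; apply: val_inj.
Qed.

Lemma separation_bound_delete (T : finType) (e : rel T) k (U : {set T}) :
  separation_bound e k (~: U) -> separation_bound (delete e U) k setT.
Proof.
move=> sep A A0 _ nocover; rewrite setIT.
rewrite -(card_imset _ val_inj) -nbhd_delete_graph setDE.
apply: sep.
- by case/set0Pn: A0 => a aA; apply/set0Pn; exists (val a); apply: imset_f.
- by apply/subsetP => _ /imsetP[a _ ->]; rewrite in_setC (valP a).
case/subsetPn: nocover => b _; rewrite in_setU negb_or => /andP[bA bN].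
apply/subsetPn; exists (val b); first by rewrite in_setC (valP b).
apply/negP => /setUP[/imsetP[a aA /val_inj ba]|bN']; first by rewrite ba aA in bA.
have : val b \in nbhd e (val @: A) :\: U by rewrite in_setD bN' (valP b).
by rewrite nbhd_delete_graph => /imsetP[c cN /val_inj bc]; rewrite bc cN in bN.
Qed.

Lemma min_degree_le (T : finType) (e : rel T) x : min_degree e <= degree e x.
Proof.
rewrite /min_degree; elim: (index_enum T) (mem_index_enum x) => // z r IH.
rewrite inE big_cons => /predU1P[->|/IH]; first exact: geq_minl.
exact: leq_trans (geq_minr _ _).
Qed.

Theorem theorem3p2 (k m : nat) (hk : 0 < k) (hm : 0 < m)
    (T : finType) (e : rel T) (he : is_simple_graph e)
    (hconn : k_connected k e) (hbip : bipartite e)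
    (hdeg : k + m <= min_degree e) :
  exists p : seq T,
    [/\ is_path e p, size p = m & k_connected k (delete e [set x in p])].
Proof.
case: he => sym irr; case: hbip => C bip.
have tf : triangle_free e.
  move=> x y z exy exz; apply/negP => eyz.
  by move: (bip _ _ exy) (bip _ _ exz) (bip _ _ eyz); do 3!case: (_ \in C).
have deg x : k + m <= #|nbr e x :&: setT|.
  by rewrite setIT; apply: leq_trans hdeg (min_degree_le e x).
have [a _] : exists a : T, true.
  have /card_gt0P[a _] : 0 < #|T|; last by exists a.
  (* On the empty vertex type [min_degree] is its neutral value 0, below [k + m]. *)
  rewrite lt0n; apply: contraTneq hdeg => T0; rewrite /min_degree big_pred0 ?T0.
    by rewrite -ltnNge addn_gt0 hk.
  by move=> x; have := fintype0 x T0.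
have big : k + m < #|T|.
  have := cardsC (nbr e a); have := deg a; rewrite setIT.
  have : 0 < #|~: nbr e a| by apply/card_gt0P; exists a; rewrite !inE irr.
  lia.
have sep := connected_separation_bound hconn.
(* [separation_path] counts the vertices after the first, hence the predecessor of [m]. *)
case: m hm hdeg deg big => // m _ _ deg big.
have [|||y [p [[_ ep up sp] [_ sepp]]]] := @separation_path T e sym tf k hk m setT setT sep.
- by move=> x _; apply: deg.
- by move=> B /and4P[B0 _ _ _]; rewrite setTI.
- by rewrite setTI; apply/set0Pn; exists a.
exists (y :: p); split; [by rewrite /is_path up | by rewrite /= sp |].
apply: separation_bound_connected.
- have := cardsC [set x in y :: p]; have -> : #|[set x in y :: p]| = m.+1.
    by rewrite cardsE (card_uniqP up) /= sp.
  have -> : #|{: {x | x \notin [set x in y :: p]}}| = #|~: [set x in y :: p]|.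
    by rewrite card_sub; apply: eq_card => x; rewrite !inE.
  lia.
by apply: separation_bound_delete; rewrite -setTD.
Qed.
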